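(* There exists an absolute constant $c>0$ with the following property. Let $k:\mathbb{N}^+\to\mathbb{R}^+$ be a monotone increasing function and let $S\subseteq\mathbb{Z}^2$ be a set of lattice points such that $|S\cap\ell\cap[1,n]^2|\le k(n)$ for every line $\ell$ and every $n\in\mathbb{N}^+$. If $$\liminf_{n\to\infty}\frac{|S\cap[1,n]^2|}{n\,k(n)}\ge 0.897,$$ then $k(n)=\Omega(n^{c})$.
   Context: $\mathbb{N}^+$ denotes the positive integers and $\mathbb{R}^+$ the positive reals. $[1,n]^2$ denotes the set of lattice points $(x,y)\in\mathbb{Z}^2$ with $1\le x\le n$ and $1\le y\le n$. ''Line'' means any straight line in $\mathbb{R}^2$. ''Monotone increasing'' is meant in the weak sense (non-decreasing; constant functions are allowed). $k(n)=\Omega(n^c)$ means that there exist $C>0$ and $n_1$ with $k(n)\ge Cn^c$ for all $n\ge n_1$. *)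

(* Defs.v *)
From HB Require Import structures.
From mathcomp Require Import all_boot all_order all_algebra finmap.
From mathcomp Require Import all_classical all_reals all_analysis.

Set Implicit Arguments.
Unset Strict Implicit.
Unset Printing Implicit Defensive.

Import Order.TTheory GRing.Theory Num.Theory.

Local Open Scope classical_set_scope.
Local Open Scope ring_scope.

Definition is_line (R : realType) (l : set (R * R)) : Prop :=
  exists a b c : R,
    (a, b) <> (0, 0) /\ l = [set p : R * R | a * p.1 + b * p.2 = c].

Definition lattice_to_plane (R : realType) (p : int * int) : R * R :=
  (p.1%:~R, p.2%:~R).

Definition box (n : nat) : set (int * int) :=
  [set p | (1 <= p.1 <= n%:Z) /\ (1 <= p.2 <= n%:Z)].

(* [fset_set A] is empty when [A] is infinite; [num_points] is only applied to
   subsets of [box n], which are finite. *)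
Definition num_points (A : set (int * int)) : nat := #|` fset_set A|.

(* A function from the positive integers to the positive reals is represented
   by [k : nat -> R], constrained at positive arguments only. *)
Definition positive_fun (R : realType) (k : nat -> R) : Prop :=
  forall n, (0 < n)%N -> 0 < k n.

Definition monotone_increasing (R : realType) (k : nat -> R) : Prop :=
  forall m n, (0 < m)%N -> (m <= n)%N -> k m <= k n.

Definition Omega_pow (R : realType) (k : nat -> R) (c : R) : Prop :=
  exists C : R, 0 < C /\
  exists n1 : nat, forall n, (0 < n)%N -> (n1 <= n)%N -> C * n%:R `^ c <= k n.

(* Main.v *)
Require Import Defs.
From HB Require Import structures.
From mathcomp Require Import all_boot all_order all_algebra finmap.
From mathcomp Require Import all_classical all_reals all_analysis.
From mathcomp Require Import zify ring lra.

Import Order.TTheory GRing.Theory Num.Theory.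

Local Open Scope classical_set_scope.
Local Open Scope ring_scope.

(** Give each lattice point (x, y) the weight 1/max(x, y) and truncate all
    weights below a scale n.  For x <= y and any scale,

      1/y <= 3/10 (1/x + 1/y) + 1/10 * 1/(y - x),

    so the weight of a point is dominated by weights attached to the column,
    the row and the diagonal of slope 1 through it ([inv_max_le_lines]).
    Each column and each row carries at most k(N) points of the box of side N,
    and the pair of diagonals |x - y| = d at most 2 k(N).  Summing over the
    points of S in that box, the total weight is therefore at most
    (2 * 3/10 + 2 * 1/10) k(N) = 8/10 k(N) times a harmonic sum over [n, N]
    ([sum_inv_max_le]).  On the other hand, writing 1/r as the telescoping sum
    of 1/(m(m+1)) over m >= r turns the total weight into a sum of
    |S cap [1,m]^2| / (m(m+1)) ([sum_count_le_sum_inv]), which the density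
    assumption bounds below by nearly 897/1000 k(n) times the same harmonic
    sum, up to a bounded error.

    Since 8/10 < 897/1000, comparing the two bounds for N = D n with D a large
    absolute constant forces k(D n) >= (16/15) k(n) for all large n: the
    harmonic sum over [4n, Dn] then exceeds 100, which absorbs the bounded
    error.  Iterating gives polynomial growth, with exponent
    c = ln (16/15) / ln D ([geometric_growth_Omega]). *)

(** * Dominating the weight of a point by those of three lines *)

(** In the main range this is 3 (y - x)^2 - 3 x (y - x) + x^2 >= 0, which is
    positive definite.  The coefficients 3/10 and 1/10 are a feasible point,
    with room to spare, of the linear program minimising their sum. The
    factor 4 in the truncation on the left is what makes the inequality survive
    near the diagonal, where the last term is only 1/10 * 1/n. *)
Lemma inv_max_le_lines_sorted (R : realType) (x y n : R) : 0 < n -> 0 <= x -> x <= y ->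
  (Num.max y (4%:R * n))^-1 <=
  3%:R / 10%:R * ((Num.max x n)^-1 + (Num.max y n)^-1)
    + 1 / 10%:R * (Num.max (y - x) n)^-1.
Proof.
move=> n0 x0 xy.
have M0 : 0 < Num.max y (4%:R * n) by rewrite lt_max; apply/orP; right; lra.
have [xn|nx] := lerP x n.
  have yM : (Num.max y (4 * n))^-1 <= (4 * n)^-1.
    by rewrite lef_pV2 ?posrE ?le_max ?lexx ?orbT//; lra.
  have E : (4%:R * n)^-1 = n^-1 / 4%:R by rewrite invfM mulrC.
  have : 0 <= (Num.max y n)^-1 by rewrite invr_ge0 le_max; apply/orP; right; lra.
  have : 0 <= (Num.max (y - x) n)^-1 by rewrite invr_ge0 le_max; apply/orP; right; lra.
  have : 0 < n^-1 by rewrite invr_gt0.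
  rewrite E in yM; lra.
have ny : n < y by lra.
rewrite (max_l (ltW ny)).
have [yxn|nyx] := lerP (y - x) n.
  have xyV : y^-1 <= x^-1 by rewrite lef_pV2 ?posrE; lra.
  have [y4|y4] := lerP y (4 * n).
    have E : (4%:R * n)^-1 = n^-1 / 4%:R by rewrite invfM mulrC.
    have : (4 * n)^-1 <= y^-1 by rewrite lef_pV2 ?posrE; lra.
    rewrite E; lra.
  have E : (4%:R * n)^-1 = n^-1 / 4%:R by rewrite invfM mulrC.
  have : y^-1 <= (4 * n)^-1 by rewrite lef_pV2 ?posrE; lra.
  rewrite E; lra.
apply: (@le_trans _ _ y^-1).
  by rewrite lef_pV2 ?posrE ?le_max ?lexx//; lra.
have x0' : 0 < x by lra.
have y0' : 0 < y by lra.
have d0 : 0 < y - x by lra.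
rewrite -subr_ge0.
have -> : 3%:R / 10%:R * (x^-1 + y^-1) + 1 / 10%:R * (y - x)^-1 - y^-1 =
  (3%:R * y * (y - x) + x * y - 7%:R * x * (y - x)) / (10%:R * x * y * (y - x)).
  by field; rewrite !gt_eqF.
apply: divr_ge0; last by rewrite !mulr_ge0//; lra.
(* 3 (d - x/2)^2 + x^2/4 with d := y - x *)
have := sqr_ge0 (y - x - x / 2%:R); have := sqr_ge0 x; rewrite !expr2; lra.
Qed.

Lemma inv_max_le_lines (R : realType) (a b n : nat) : (0 < n)%N ->
  (maxn (maxn a b) (4 * n))%:R^-1 <=
  3%:R / 10%:R * ((maxn a n)%:R^-1 + (maxn b n)%:R^-1)
    + 1 / 10%:R * (maxn `|a%:Z - b%:Z|%N n)%:R^-1 :> R.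
Proof.
move=> n0; wlog ab : a b / (a <= b)%N => [wl|].
  case/orP: (leq_total a b) => /wl //.
  by rewrite distnC (maxnC b a) (addrC (_ b n)%:R^-1).
rewrite distnC distnEl// (maxn_idPr ab) -!maxEnat !natr_max natrM natrB//.
by apply: inv_max_le_lines_sorted; rewrite ?ltr0n ?ler_nat.
Qed.

(** * Summation *)

(** Group the points by the value of [phi], that is, by the line of a given
    family on which they lie. *)
Lemma sum_fiber_le (R : realType) (T : eqType) (s : seq T) (phi : T -> nat) (h : nat -> R)
    (N : nat) (K : R) :
  (forall i, 0 <= h i) ->
  {in s, forall p, (phi p <= N)%N} ->
  (forall i, (count (fun p => phi p == i) s)%:R <= K) ->
  \sum_(p <- s) h (phi p) <= K * \sum_(0 <= i < N.+1) h i.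
Proof.
move=> h0 sN cK.
have -> : \sum_(p <- s) h (phi p) =
    \sum_(p <- s) \sum_(0 <= i < N.+1 | phi p == i) h i.
  apply: eq_big_seq => p /sN pN.
  rewrite big_mkcond (bigD1_seq (phi p)) ?iota_uniq ?mem_index_iota//= eqxx.
  by rewrite big1 ?addr0// => i; rewrite eq_sym => /negbTE ->.
rewrite (exchange_big_dep predT)//= mulr_sumr; apply: ler_sum => i _.
rewrite big_const_seq iter_addr_0 -mulr_natl.
by rewrite ler_wpM2r// cK.
Qed.

Lemma telescope_inv (R : realType) (q N : nat) : (0 < q)%N ->
  \sum_(q <= m < N) (m%:R * m.+1%:R)^-1 <= q%:R^-1 :> R.
Proof.
move=> q0; have [Nq|qN] := leqP N q; first by rewrite big_geq// invr_ge0.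
rewrite (@eq_big_nat _ _ _ _ _ _ (fun m => (- m.+1%:R^-1) - (- m%:R^-1))); last first.
  move=> m /andP[qm _]; have m0 : m%:R != 0 :> R by rewrite pnatr_eq0; lia.
  have : m.+1%:R != 0 :> R by rewrite pnatr_eq0.
  by rewrite -natr1 => m1; field; rewrite m0 m1.
by rewrite telescope_sumr 1?ltnW// opprK gerDr oppr_le0 invr_ge0.
Qed.

(** Abel summation in the form of a layer-cake formula: 1/max(r, q) is the sum
    of 1/(m(m+1)) over m >= max(r, q), and exchanging the sums counts the
    points with r <= m. *)
Lemma sum_count_le_sum_inv (R : realType) (T : eqType) (s : seq T) (r : T -> nat) (q N : nat) :
  (0 < q)%N ->
  \sum_(q <= m < N) (count (fun p => (r p <= m)%N) s)%:R / (m%:R * m.+1%:R)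
    <= \sum_(p <- s) (maxn (r p) q)%:R^-1 :> R.
Proof.
move=> q0.
have -> : \sum_(q <= m < N) (count (fun p => (r p <= m)%N) s)%:R / (m%:R * m.+1%:R)
  = \sum_(q <= m < N) \sum_(p <- s | (r p <= m)%N) (m%:R * m.+1%:R)^-1 :> R.
  by apply: eq_bigr => m _; rewrite big_const_seq iter_addr_0 mulr_natl.
rewrite (exchange_big_dep predT)//=; apply: ler_sum => p _.
apply: le_trans (telescope_inv R (maxn (r p) q) N _); last by lia.
rewrite [leRHS](big_nat_widenl _ q) ?leq_maxr//= big_nat_cond [leRHS]big_nat_cond.
rewrite le_eqVlt; apply/orP; left; apply/eqP; apply: eq_bigl => m; lia.
Qed.

Lemma harmonic_block (R : realType) (n : nat) : (0 < n)%N ->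
  1 / 2%:R <= \sum_(n <= m < n * 2) m.+1%:R^-1 :> R.
Proof.
move=> n0.
have -> : 1 / 2%:R = \sum_(n <= m < n * 2) (n * 2)%:R^-1 :> R.
  rewrite big_const_nat iter_addr_0 -[RHS]mulr_natl muln2 -addnn addnK natrD.
  by field; rewrite -?natrD ?pnatr_eq0; lia.
by apply: ler_sum_nat => m /andP[_ m2]; rewrite lef_pV2 ?posrE ?ler_nat ?ltr0n//; lia.
Qed.

Lemma harmonic_dyadic (R : realType) (n j : nat) : (0 < n)%N ->
  j%:R / 2%:R <= \sum_(n <= m < n * 2 ^ j) m.+1%:R^-1 :> R.
Proof.
move=> n0; elim: j => [|j IH]; first by rewrite mul0r sumr_ge0.
have nj : (0 < n * 2 ^ j)%N by rewrite muln_gt0 n0 expn_gt0.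
rewrite expnSr mulnA (@big_cat_nat _ _ _ (n * 2 ^ j))//=; last 2 first.
- by rewrite leq_pmulr// expn_gt0.
- by rewrite leq_pmulr.
have := harmonic_block R (n * 2 ^ j) nj; rewrite -(natr1 j); lra.
Qed.

(** The ratio [D] does not depend on the scale [n]: this is why the final
    exponent is absolute. *)
Lemma harmonic_ratio (R : realType) (L : nat) : exists2 D : nat, (1 < D)%N &
  forall n, (0 < n)%N -> L%:R <= \sum_(4 * n <= m < D * n) m.+1%:R^-1 :> R.
Proof.
exists (4 * 2 ^ (L * 2))%N => [|n n0].
  by apply: (@leq_trans (4 * 1)%N) => //; rewrite leq_mul// expn_gt0.
have := harmonic_dyadic R (4 * n) (L * 2); rewrite mulnAC natrM mulfK ?pnatr_eq0//.
by apply; rewrite muln_gt0.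
Qed.

(** The upper bound runs over all line indices and the lower bound over scales
    in [4n, N]: both harmonic sums agree up to a bounded error, the indices
    below 4n contributing at most (4n + 1)/n. *)
Lemma truncated_harmonic (R : realType) (n N : nat) : (0 < n)%N -> (4 * n <= N)%N ->
  \sum_(0 <= i < N.+1) (maxn i n)%:R^-1
    <= \sum_(4 * n <= m < N) m.+1%:R^-1 + 5%:R :> R.
Proof.
move=> n0 nN.
rewrite (@big_cat_nat _ _ _ (4 * n).+1)//= addrC big_add1; apply: lerD.
  by apply: ler_sum_nat => m mN; rewrite lef_pV2 ?posrE ?ler_nat ?ltr0n//; lia.
apply: (@le_trans _ _ (\sum_(0 <= i < (4 * n).+1) n%:R^-1)).
  by apply: ler_sum => m _; rewrite lef_pV2 ?posrE ?ler_nat ?ltr0n//; lia.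
rewrite big_const_nat iter_addr_0 subn0 -[leLHS]mulr_natl ler_pdivrMr ?ltr0n//.
by rewrite -natrM ler_nat; lia.
Qed.

(** * Points of a box and their distribution on lines *)

Lemma finite_box (n : nat) : finite_set (box n).
Proof.
apply: (@sub_finite_set _ _ ((fun p : nat * nat => (p.1%:Z, p.2%:Z)) @` (`I_n.+1 `*` `I_n.+1))).
  move=> [[a|a] [b|b]] [/=]; rewrite ?ltr0n //; try by lia.
  by move=> a_n b_n; exists (a, b) => //=; split => /=; lia.
by apply: finite_image; apply: finite_setX; exact: finite_II.
Qed.

Definition points (S : set (int * int)) (N : nat) : seq (int * int) :=
  enum_fset (fset_set (S `&` box N)).

Lemma mem_points (S : set (int * int)) (N : nat) (p : int * int) :
  reflect (S p /\ box N p) (p \in points S N).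
Proof.
have -> : (p \in points S N) = (p \in S `&` box N).
  by rewrite -in_fset_set//; apply: finite_setIr; exact: finite_box.
by apply: (iffP idP); rewrite inE.
Qed.

Lemma num_points_ge (A : set (int * int)) (s : seq (int * int)) :
  finite_set A -> uniq s -> {in s, forall p, A p} -> (size s <= num_points A)%N.
Proof.
move=> finA us sA; apply: uniq_leq_size => // p /sA Ap.
by rewrite in_fset_set// inE.
Qed.

Lemma count_points_box (S : set (int * int)) (m N : nat) : (m <= N)%N ->
  (num_points (S `&` box m) <=
   count (fun p => (maxn `|p.1|%N `|p.2|%N <= m)%N) (points S N))%N.
Proof.
move=> mN; rewrite -size_filter.
have le_m (p : int * int) : box m p -> (maxn `|p.1|%N `|p.2|%N <= m)%N.
  by move=> [/= ? ?]; lia.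
have le_N (p : int * int) : box m p -> box N p by move=> [/= ? ?]; split=> /=; lia.
have sub (p : int * int) : S p /\ box m p ->
    p \in [seq p <- points S N | (maxn `|p.1|%N `|p.2|%N <= m)%N].
  move=> [Sp bp]; rewrite mem_filter; apply/andP; split; first exact: le_m.
  by apply/mem_points; split => //; exact: le_N.
by apply: uniq_leq_size => [|p /mem_points/sub]; first exact: fset_uniq.
Qed.

Definition line_bounded (R : realType) (S : set (int * int)) (N : nat) (K : R) :=
  forall l : set (R * R), is_line l ->
    (num_points (S `&` (@lattice_to_plane R @^-1` l) `&` box N))%:R <= K.

Lemma count_line (R : realType) (S : set (int * int)) (N : nat) (K : R)
    (f : pred (int * int)) (a b c : int) :
  line_bounded R S N K -> (a, b) <> (0, 0) ->
  {in points S N, forall p, f p -> a * p.1 + b * p.2 = c} ->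
  (count f (points S N))%:R <= K.
Proof.
move=> kS ab fl.
set l := [set p : R * R | a%:~R * p.1 + b%:~R * p.2 = c%:~R].
apply: le_trans (kS l _); last first.
  exists a%:~R, b%:~R, c%:~R; split => // -[/eqP + /eqP].
  by rewrite !intr_eq0 => /eqP a0 /eqP b0; apply: ab; rewrite a0 b0.
rewrite ler_nat -size_filter; apply: num_points_ge.
- by apply: finite_setIr; exact: finite_box.
- by rewrite filter_uniq//; exact: fset_uniq.
move=> p; rewrite mem_filter => /andP[fp pS]; have /mem_points[Sp bp] := pS.
split => //; split => //; rewrite /l /lattice_to_plane/=.
by rewrite -!intrM -intrD fl.
Qed.

Lemma count_column (R : realType) (S : set (int * int)) (N : nat) (K : R) (i : nat) :
  line_bounded R S N K ->
  (count (fun p => `|p.1|%N == i) (points S N))%:R <= K.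
Proof.
by move=> kS; apply: (@count_line _ _ _ _ _ 1 0 i%:Z) => // p /mem_points[_ [/= ? ?]] /eqP; lia.
Qed.

Lemma count_row (R : realType) (S : set (int * int)) (N : nat) (K : R) (i : nat) :
  line_bounded R S N K ->
  (count (fun p => `|p.2|%N == i) (points S N))%:R <= K.
Proof.
by move=> kS; apply: (@count_line _ _ _ _ _ 0 1 i%:Z) => // p /mem_points[_ [/= ? ?]] /eqP; lia.
Qed.

(** The factor 2 comes from the two lines x - y = i and x - y = - i. *)
Lemma count_diagonal (R : realType) (S : set (int * int)) (N : nat) (K : R) (i : nat) :
  line_bounded R S N K ->
  (count (fun p => `|p.1 - p.2|%N == i) (points S N))%:R <= 2%:R * K.
Proof.
move=> kS; set P := points S N.
have c1 : (count (fun p => p.1 - p.2 == i%:Z) P)%:R <= K.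
  by apply: (@count_line _ _ _ _ _ 1 (-1) i%:Z) => // p _ /eqP <-; rewrite mul1r mulN1r.
have c2 : (count (fun p => p.1 - p.2 == - i%:Z) P)%:R <= K.
  by apply: (@count_line _ _ _ _ _ 1 (-1) (- i%:Z)) => // p _ /eqP <-; rewrite mul1r mulN1r.
apply: (@le_trans _ _ ((count (fun p => p.1 - p.2 == i%:Z) P +
                        count (fun p => p.1 - p.2 == - i%:Z) P)%:R)).
  rewrite ler_nat -count_predUI; apply: leq_trans (leq_addr _ _).
  by apply: sub_count => p /= /eqP ?; apply/orP; lia.
by rewrite natrD; lra.
Qed.

(** * Comparing two scales *)

Lemma sum_inv_max_le (R : realType) (S : set (int * int)) (N : nat) (K : R) (n : nat) :
  line_bounded R S N K -> (0 < n)%N ->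
  \sum_(p <- points S N) (maxn (maxn `|p.1|%N `|p.2|%N) (4 * n))%:R^-1
    <= 8%:R / 10%:R * K * \sum_(0 <= i < N.+1) (maxn i n)%:R^-1.
Proof.
move=> kS n0; set W := \sum_(0 <= i < N.+1) _; set P := points S N.
pose h i : R := (maxn i n)%:R^-1.
have h0 i : 0 <= h i by rewrite invr_ge0.
have col : \sum_(p <- P) h `|p.1|%N <= K * W.
  by apply: sum_fiber_le h0 _ (count_column R S N K ^~ kS) => p /mem_points[_ [/= ? ?]]; lia.
have row : \sum_(p <- P) h `|p.2|%N <= K * W.
  by apply: sum_fiber_le h0 _ (count_row R S N K ^~ kS) => p /mem_points[_ [/= ? ?]]; lia.
have diag : \sum_(p <- P) h `|p.1 - p.2|%N <= 2%:R * K * W.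
  by apply: sum_fiber_le h0 _ (count_diagonal R S N K ^~ kS) => p /mem_points[_ [/= ? ?]]; lia.
have inv_max_le_box (p : int * int) : box N p ->
    (maxn (maxn `|p.1|%N `|p.2|%N) (4 * n))%:R^-1 <=
    3%:R / 10%:R * (h `|p.1|%N + h `|p.2|%N) + 1 / 10%:R * h `|p.1 - p.2|%N.
  move=> [/= ? ?]; have := inv_max_le_lines R `|p.1|%N `|p.2|%N n n0.
  have -> : `|p.1|%N%:Z = p.1 by lia.
  by have -> : `|p.2|%N%:Z = p.2 by lia.
apply: (@le_trans _ _ (\sum_(p <- P)
    (3%:R / 10%:R * (h `|p.1|%N + h `|p.2|%N) + 1 / 10%:R * h `|p.1 - p.2|%N))).
  rewrite big_seq [leRHS]big_seq; apply: ler_sum => p /mem_points[_].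
  exact: (inv_max_le_box p).
rewrite big_split/= -!mulr_sumr big_split/=; lra.
Qed.

(** As the harmonic sum [L] grows, its contribution dominates the constant 5,
    so a density [delta] above 8/10 makes [k N] exceed [k n] by a fixed
    factor. *)
Lemma growth_step (R : realType) (S : set (int * int)) (k : nat -> R)
    (n N : nat) (delta L : R) :
  L = \sum_(4 * n <= m < N) m.+1%:R^-1 ->
  line_bounded R S N (k N) -> monotone_increasing k -> 0 <= k N -> (0 < n)%N -> (4 * n <= N)%N ->
  0 <= delta ->
  (forall m, (n <= m)%N -> delta * (m%:R * k m) <= (num_points (S `&` box m))%:R) ->
  delta * k n * L <= 8%:R / 10%:R * k N * (L + 5%:R).
Proof.
move=> LE kS kmono kN0 n0 nN d0 dens.
have n4 : (0 < 4 * n)%N by lia.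
have : 8%:R / 10%:R * k N * \sum_(0 <= i < N.+1) (maxn i n)%:R^-1
    <= 8%:R / 10%:R * k N * (L + 5%:R).
  by rewrite LE; apply: ler_wpM2l; [lra | exact: truncated_harmonic].
apply: le_trans; apply: le_trans (sum_inv_max_le R S N _ n kS n0).
apply: le_trans (sum_count_le_sum_inv R _ (points S N) _ (4 * n) N n4).
rewrite LE mulr_sumr; apply: ler_sum_nat => m /andP[m4 mN].
have m0 : 0 < m%:R :> R by rewrite ltr0n; lia.
have -> : delta * k n * m.+1%:R^-1 = delta * (m%:R * k n) / (m%:R * m.+1%:R).
  by field; rewrite gt_eqF ?ltr0n//= gt_eqF.
apply: ler_wpM2r; first by rewrite invr_ge0 mulr_ge0.
apply: (@le_trans _ _ (delta * (m%:R * k m))).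
  by apply: ler_wpM2l => //; rewrite ler_pM2l//; apply: kmono => //; lia.
apply: le_trans (dens m _) _; first by lia.
by rewrite ler_nat; apply: count_points_box; lia.
Qed.

(** * From comparison of scales to polynomial growth *)

Lemma limn_einf_lower (R : realType) (u : nat -> R) (a b : R) : b < a ->
  (a%:E <= limn_einf (fun n => (u n)%:E))%E ->
  exists n0 : nat, forall n, (n0 <= n)%N -> b <= u n.
Proof.
move=> ba; rewrite /limn_einf /limn_esup -/(limf_einf _ _) limf_einfE => aE.
have ba' : (b%:E < a%:E)%E by rewrite lte_fin.
have /ereal_sup_gt[_ [V [n0 _ n0V] <-] bV] := lt_le_trans ba' aE.
exists n0 => n n0n; rewrite -lee_fin; apply: le_trans (ltW bV) _.
by apply: ereal_inf_lbound; exists n => //; exact: n0V.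
Qed.

Lemma geometric_growth_Omega (R : realType) (k : nat -> R) (D n0 : nat) (q : R) :
  monotone_increasing k -> (1 < D)%N -> (0 < n0)%N -> 1 < q -> 0 < k n0 ->
  (forall n, (n0 <= n)%N -> q * k n <= k (D * n)%N) ->
  Omega_pow k (ln q / ln D%:R).
Proof.
move=> kmono D1 n00 q1 k0 kD; set c := ln q / ln D%:R.
have lnD : 0 < ln D%:R :> R by rewrite ln_gt0// ltr1n.
have c0 : 0 <= c by rewrite divr_ge0// ?ltW// ln_gt0.
have q0 : 0 < q by lra.
have Dc : D%:R `^ c = q.
  by rewrite /powR pnatr_eq0 gtn_eqF 1?ltnW// /c divfK ?gt_eqF// lnK ?posrE.
have kj j : q ^+ j * k n0 <= k (D ^ j * n0)%N.
  elim: j => [|j IH]; first by rewrite expr0 mul1r expn0 mul1n.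
  rewrite expnS -mulnA; apply: le_trans (kD _ _); last first.
    by rewrite leq_pmull// expn_gt0 ltnW.
  by rewrite exprS -mulrA ler_pM2l.
have nc0 : 0 < n0%:R `^ c by apply: powR_gt0; rewrite ltr0n.
exists (k n0 / (q * n0%:R `^ c)); split; first by rewrite divr_gt0// mulr_gt0.
exists n0 => n n_gt0 n0n.
have d0 : (0 < n %/ n0)%N by rewrite divn_gt0.
have /andP[lo hi] := trunc_log_bounds D1 d0.
set j := trunc_log D _ in lo hi.
rewrite leq_divRL// in lo; rewrite ltn_divLR// in hi.
have knj : q ^+ j * k n0 <= k n.
  apply: le_trans (kj j) _; apply: kmono => //.
  by rewrite muln_gt0 n00 expn_gt0 ltnW.
apply: le_trans knj.
have : n%:R `^ c <= q ^+ j.+1 * n0%:R `^ c.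
  have -> : q ^+ j.+1 * n0%:R `^ c = (D ^ j.+1 * n0)%:R `^ c.
    rewrite natrM powRM// natrX; congr (_ * _).
    by rewrite -[in RHS]powR_mulrn// -powRrM mulrC powRrM Dc powR_mulrn// ltW.
  by apply: ge0_ler_powR; rewrite ?nnegrE ?ler0n// ler_nat ltnW.
move=> le; rewrite mulrAC ler_pdivrMr ?mulr_gt0//.
apply: le_trans (ler_wpM2l (ltW k0) le) _.
by rewrite exprS le_eqVlt; apply/orP; left; apply/eqP; ring.
Qed.

Theorem theorem1p6 (R : realType) :
  exists c : R, 0 < c /\
  forall (k : nat -> R) (S : set (int * int)),
    positive_fun k ->
    monotone_increasing k ->
    (forall l : set (R * R), is_line l ->
       forall n : nat, (0 < n)%N ->
         (num_points (S `&` (@lattice_to_plane R @^-1` l) `&` box n))%:R <= k n) ->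
    ((897%:R / 1000%:R : R)%:E <=
       limn_einf (fun n : nat => ((num_points (S `&` box n))%:R / (n%:R * k n))%:E))%E ->
    Omega_pow k c.
Proof.
have [D D1 DL] := harmonic_ratio R 100.
exists (ln (16%:R / 15%:R) / ln D%:R); split.
  by rewrite divr_gt0// ln_gt0 ?ltr1n//; lra.
move=> k S kpos kmono kS.
have ba : 896%:R / 1000%:R < 897%:R / 1000%:R :> R by lra.
move=> /(limn_einf_lower _ _ _ _ ba)[n1 dens].
have n0 : (0 < maxn n1 1)%N by lia.
apply: (geometric_growth_Omega _ _ _ _ _ kmono D1 n0) (kpos _ n0) _; first by lra.
move=> n n1n.
have n_gt0 : (0 < n)%N by lia.
have [nN|Nn] := leqP (4 * n) (D * n); last first.
  by have := DL n n_gt0; rewrite big_geq ?lern0// ltnW.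
have N0 : (0 < D * n)%N by lia.
have kN0 := kpos _ N0.
have dens' m : (n <= m)%N ->
    896%:R / 1000%:R * (m%:R * k m) <= (num_points (S `&` box m))%:R.
  move=> nm; have m0 : (0 < m)%N by lia.
  rewrite -ler_pdivlMr ?mulr_gt0 ?ltr0n ?kpos//.
  by apply: dens; lia.
pose L : R := \sum_(4 * n <= m < D * n) m.+1%:R^-1.
have L100 : 100%:R <= L := DL n n_gt0.
have := growth_step _ _ _ _ _ _ L erefl (fun l hl => kS l hl _ N0) kmono
  (ltW kN0) n_gt0 nN (_ : 0 <= 896%:R / 1000%:R) dens'.
move=> /(_ ltac:(lra)) le.
have L0 : 0 < L by lra.
rewrite -(ler_pM2r L0).
(* L >= 100 gives 8/10 (L + 5) <= 84/100 L, and (896/1000) / (84/100) = 16/15. *)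
have : 500%:R * k (D * n)%N <= 5%:R * (L * k (D * n)%N).
  rewrite mulrA ler_pM2r//; lra.
lra.
Qed.
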